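(* Let $A$ be a closed symmetric operator in a Hilbert space $\mathfrak H_1$ with equal defect numbers and let $\Pi=\{\mathcal H,\Gamma_0,\Gamma_1\}$ be an ordinary boundary triplet for $A^*$ with Weyl function $M(\lambda)$. Let $S_2$ be a closed symmetric operator in a Hilbert space $\mathfrak H_2$, let $\chi:\mathfrak H_2^2\to\mathcal H^2$ be a boundary relation for $S_2^*$ with domain $\operatorname{dom}\chi=T_2$ and Weyl family $\tau(\lambda)=\{\Phi(\lambda),\Psi(\lambda)\}\in\widetilde R(\mathcal H)$, and let $\widetilde{\mathfrak H}=\mathfrak H_1\oplus\mathfrak H_2$. Then: (i) the linear relation $$H^{(1)}=\Big\{\widehat f_1\oplus\widehat f_2\in A^*\oplus T_2:\ \Gamma_0\widehat f_1=0,\ \Big\{\widehat f_2,\begin{pmatrix}0\\ -\Gamma_1\widehat f_1\end{pmatrix}\Big\}\in\chi\Big\}$$ is a closed symmetric linear relation in $\widetilde{\mathfrak H}$; (ii) the linear relation $\Gamma^{(1)}:\widetilde{\mathfrak H}^2\to\mathcal H^2$ given by $$\Gamma^{(1)}=\Big\{\Big\{\widehat f_1\oplus\widehat f_2,\begin{pmatrix}\Gamma_1\widehat f_1+h'\\ -\Gamma_0\widehat f_1\end{pmatrix}\Big\}:\ \widehat f_1\in A^*,\ \Big\{\widehat f_2,\begin{pmatrix}\Gamma_0\widehat f_1\\ h'\end{pmatrix}\Big\}\in\chi\Big\}$$ is a boundary relation for $(H^{(1)})^*$ which satisfies the conditions (B1)–(B3); (iii) the Weyl function $M^{(1)}(\lambda)$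 of $H^{(1)}$ corresponding to $\Gamma^{(1)}$ is $$M^{(1)}(\lambda)=-\Phi(\lambda)(\Psi(\lambda)+M(\lambda)\Phi(\lambda))^{-1};$$ (iv) the linear relation $$H^{(2)}=\Big\{\widehat f_1\oplus\widehat f_2\in A^*\oplus T_2:\ \Gamma_1\widehat f_1=0,\ \Big\{\widehat f_2,\begin{pmatrix}\Gamma_0\widehat f_1\\ 0\end{pmatrix}\Big\}\in\chi\Big\}$$ is a closed symmetric linear relation in $\widetilde{\mathfrak H}$; (v) the linear relation $\Gamma^{(2)}:\widetilde{\mathfrak H}^2\to\mathcal H^2$ given by $$\Gamma^{(2)}=\Big\{\Big\{\widehat f_1\oplus\widehat f_2,\begin{pmatrix}-\Gamma_0\widehat f_1+h\\ -\Gamma_1\widehat f_1\end{pmatrix}\Big\}:\ \widehat f_1\in A^*,\ \Big\{\widehat f_2,\begin{pmatrix}h\\ -\Gamma_1\widehat f_1\end{pmatrix}\Big\}\in\chi\Big\}$$ is a boundary relation for $(H^{(2)})^*$ which satisfies the conditions (B1)–(B3); (vi) the Weyl function $M^{(2)}(\lambda)$ of $H^{(2)}$ corresponding to $\Gamma^{(2)}$ is $$M^{(2)}(\lambda)=\Psi(\lambda)(\Psi(\lambda)+M(\lambda)\Phi(\lambda))^{-1}M(\lambda).$$ (In (iii) and (vi), $\lambda\in\mathbb C\setminus\mathbb R$.)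
   Context: A linear relation from $\mathfrak H_1$ to $\mathfrak H_2$ is a linear subspace of $\mathfrak H_1\times\mathfrak H_2$. Write $\widehat f=\{f,f'\}$ etc.; pairs are also written as columns; $\widehat f_1\oplus\widehat f_2=\{f_1\oplus f_2,f_1'\oplus f_2'\}$. $A^*$ is the adjoint linear relation. Ordinary boundary triplet for $A^*$ (where $n_+(A)=n_-(A)$): a triplet $\{\mathcal H,\Gamma_0,\Gamma_1\}$ with $\mathcal H$ a Hilbert space, $\dim\mathcal H=n_\pm(A)$, and $\Gamma_0,\Gamma_1$ bounded linear operators from $A^*$ (graph inner product) to $\mathcal H$ such that $(f',g)-(f,g')=(\Gamma_1\widehat f,\Gamma_0\widehat g)_{\mathcal H}-(\Gamma_0\widehat f,\Gamma_1\widehat g)_{\mathcal H}$ for all $\widehat f,\widehat g\in A^*$ and $\{\Gamma_0,\Gamma_1\}:A^*\to\mathcal H^2$ is surjective. Its Weyl function is the operator function with $\Gamma_1\widehat f_\lambda=M(\lambda)\Gamma_0\widehat f_\lambda$ for all $\widehat f_\lambda=\{f_\lambda,\lambda f_\lambda\}\in A^*$. Boundary relation: for a closed symmetric linear relation $S$ in $\mathfrak H$, a linear relation $\Gamma:\mathfrak H^2\to\mathcal H^2$ is a boundary relation for $S^*$ if (G1) $\operatorname{dom}\Gamma$ is dense in $S^*$ and $(f',g)_{\mathfrak H}-(f,g')_{\mathfrak H}=(h',k)_{\mathcal H}-(h,k')_{\mathcal H}$ (Green's identity) for all $\{\widehat f,\widehat h\},\{\widehat g,\widehat k\}\in\Gamma$;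 (G2) every $\{\widehat g,\widehat k\}\in\mathfrak H^2\times\mathcal H^2$ satisfying this identity for all $\{\widehat f,\widehat h\}\in\Gamma$ belongs to $\Gamma$. Weyl family: $M(\lambda)=\{\widehat h\in\mathcal H^2:\{\widehat f_\lambda,\widehat h\}\in\Gamma\text{ for some }\widehat f_\lambda=\{f,\lambda f\}\}$, $\lambda\in\mathbb C\setminus\mathbb R$ (called Weyl function if operator-valued). Put $\Gamma_0=\{\{\widehat f,h\}:\{\widehat f,\widehat h\}\in\Gamma,\ \widehat h=\{h,h'\}\}$. Conditions (B1)–(B3): (B1) Green's identity holds; (B2) $\operatorname{ran}\Gamma_0=\mathcal H$; (B3) $\ker\Gamma_0$ is a selfadjoint linear relation. $\widetilde R(\mathcal H)$ is the class of Nevanlinna families: families of linear relations $\tau(\lambda)$, $\lambda\in\mathbb C\setminus\mathbb R$, in $\mathcal H$, maximal dissipative for $\lambda\in\mathbb C_+$ (maximal accumulative for $\lambda\in\mathbb C_-$), with $\tau(\lambda)^*=\tau(\bar\lambda)$ and $(\tau(\lambda)+\mu)^{-1}$ bounded everywhere defined and holomorphic in $\lambda\in\mathbb C_\pm$ for $\mu\in\mathbb C_\pm$. Weyl families belong to $\widetilde R(\mathcal H)$, and each $\tau\in\widetilde R(\mathcal H)$ has a representation $\tau(\lambda)=\{\Phi(\lambda),\Psi(\lambda)\}:=\{\{\Phi(\lambda)h,\Psi(\lambda)h\}:h\in\mathcal H\}$ with a Nevanlinna pair $\{\Phi,\Psi\}$, i.e. holomorphic functions on $\mathbb C\setminus\mathbb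 R$ with values bounded operators on $\mathcal H$ such that $\operatorname{Im}(\Phi(\lambda)^*\Psi(\lambda))/\operatorname{Im}\lambda\ge0$, $\Psi(\bar\lambda)^*\Phi(\lambda)-\Phi(\bar\lambda)^*\Psi(\lambda)=0$, and $0\in\rho(\Psi(\lambda)\pm i\Phi(\lambda))$ for $\lambda\in\mathbb C_\pm$. *)

(* Defs.v *)
From HB Require Import structures.
From mathcomp Require Import all_boot all_order all_algebra.
From mathcomp Require Import ring complex sesquilinear.
From mathcomp Require Import all_classical all_reals all_analysis.

Set Implicit Arguments.
Unset Strict Implicit.
Unset Printing Implicit Defensive.

Import Order.TTheory GRing.Theory Num.Theory.
Import numFieldNormedType.Exports.

Local Open Scope classical_set_scope.
Local Open Scope ring_scope.

HB.mixin Record CompleteNormedModule_isHilbert (R : realType) (H : Type)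
    & CompleteNormedModule R[i] H := {
  inner : {dot H for Num.conj};
  normr_inner : forall x : H, `|x| ^+ 2 = inner x x
}.

#[short(type="hilbertType")]
HB.structure Definition Hilbert (R : realType) :=
  {H of CompleteNormedModule R[i] H & CompleteNormedModule_isHilbert R H}.

Notation "''[' u , v ]" := (inner u%R v%R) : ring_scope.

(* H1 (+) H2: the library's norm on H1 * H2 is the maximum norm, hence a separate
   carrier for the Hilbert space sum. *)
Definition hsum (R : realType) (H1 H2 : hilbertType R) : Type := (H1 * H2)%type.

Section HilbertSum.
Context {R : realType} (H1 H2 : hilbertType R).
Local Notation C := R[i].
Local Notation S := (hsum H1 H2).

HB.instance Definition _ := GRing.Lmodule.copy S (H1 * H2)%type.

Definition hsum_norm (u : S) : C := sqrtC (`|u.1| ^+ 2 + `|u.2| ^+ 2).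

Let sumsq_ge0 (u : S) : 0 <= `|u.1| ^+ 2 + `|u.2| ^+ 2 :> C.
Proof. by rewrite addr_ge0 ?exprn_ge0. Qed.

Let hsum_norm_ge0 (u : S) : 0 <= hsum_norm u.
Proof. by rewrite sqrtC_ge0. Qed.

Let sqr_hsum_norm (u : S) : hsum_norm u ^+ 2 = `|u.1| ^+ 2 + `|u.2| ^+ 2.
Proof. by rewrite sqrtCK. Qed.

Fact ler_hsum_normD (u v : S) : hsum_norm (u + v) <= hsum_norm u + hsum_norm v.
Proof.
rewrite -(ler_pXn2r (ltn0Sn 1)) ?nnegrE ?addr_ge0// sqrrD !sqr_hsum_norm.
set a := `|u.1|; set b := `|u.2|; set c := `|v.1|; set d := `|v.2|.
have [a0 b0 c0 d0] : [/\ 0 <= a, 0 <= b, 0 <= c & 0 <= d].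
  by split; exact: normr_ge0.
have ar : a \is Num.real by exact: normr_real.
have br : b \is Num.real by exact: normr_real.
have cr : c \is Num.real by exact: normr_real.
have dr : d \is Num.real by exact: normr_real.
apply: (@le_trans _ _ ((a + c) ^+ 2 + (b + d) ^+ 2)).
  by apply: lerD; rewrite ler_pXn2r ?nnegrE ?addr_ge0 ?a0 ?b0 ?c0 ?d0//;
    exact: ler_normD.
have -> : (a + c) ^+ 2 + (b + d) ^+ 2 =
    (a * c + b * d) *+ 2 + (a ^+ 2 + b ^+ 2 + (c ^+ 2 + d ^+ 2)).
  by rewrite !sqrrD mulrnDl; ring.
rewrite [leRHS]addrAC [leRHS]addrC lerD2r lerMn2r /=.
rewrite -(ler_pXn2r (ltn0Sn 1)) ?nnegrE ?addr_ge0 ?mulr_ge0 ?a0 ?b0 ?c0 ?d0//.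
rewrite exprMn !sqr_hsum_norm -/a -/b -/c -/d -subr_ge0.
have -> : (a ^+ 2 + b ^+ 2) * (c ^+ 2 + d ^+ 2) - (a * c + b * d) ^+ 2 =
  (a * d - b * c) ^+ 2 by ring.
by rewrite real_exprn_even_ge0// rpredB// rpredM.
Qed.

Fact hsum_normZ (a : C) (u : S) : hsum_norm (a *: u) = `|a| * hsum_norm u.
Proof.
rewrite /hsum_norm !normrZ !exprMn -mulrDr.
by rewrite sqrtCM ?nnegrE ?exprn_ge0// sqrCK.
Qed.

Fact hsum_norm0_eq0 (u : S) : hsum_norm u = 0 -> u = 0.
Proof.
move=> /eqP; rewrite sqrtC_eq0 paddr_eq0 ?exprn_ge0// !sqrf_eq0 !normr_eq0.
by case: u => u1 u2 /= /andP[/eqP-> /eqP->].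
Qed.

HB.instance Definition _ :=
  @Lmodule_isNormed.Build C S hsum_norm ler_hsum_normD hsum_normZ hsum_norm0_eq0.

Let ler_norm_fst (u : S) : `|u.1| <= `|u|.
Proof.
rewrite -(ler_pXn2r (ltn0Sn 1)) ?nnegrE// sqr_hsum_norm lerDl.
by rewrite exprn_ge0.
Qed.

Let ler_norm_snd (u : S) : `|u.2| <= `|u|.
Proof.
rewrite -(ler_pXn2r (ltn0Sn 1)) ?nnegrE// sqr_hsum_norm lerDr.
by rewrite exprn_ge0.
Qed.

Let ler_hsum_norm (u : S) : `|u| <= `|u.1| + `|u.2|.
Proof.
rewrite -(ler_pXn2r (ltn0Sn 1)) ?nnegrE ?addr_ge0// sqr_hsum_norm sqrrD.
by rewrite addrAC lerDl mulrn_wge0// mulr_ge0.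
Qed.

Let cauchy_map (T : completeNormedModType C) (p : S -> T) (F : set_system S) :
  ProperFilter F -> (forall u v, p (u - v) = p u - p v) ->
  (forall u, `|p u| <= `|u|) -> cauchy F -> cvg (p @ F).
Proof.
move=> FF pB ple /cauchy_ballP Fc; apply: cauchy_cvg.
apply/cauchy_ballP => e e0.
have [[A B] /= [FA FB] AB] := Fc e e0.
exists (p @` A, p @` B) => /=.
  split; rewrite /fmap/=.
    by apply: filterS FA => x Ax; exists x.
  by apply: filterS FB => x Bx; exists x.
move=> [_ _] /= [[x Ax <-] [y By <-]].
have := AB (x, y) (conj Ax By).
rewrite -!ball_normE /ball_ /= -pB; exact: le_lt_trans.
Qed.

Fact hsum_complete (F : set_system S) : ProperFilter F -> cauchy F -> cvg F.
Proof.
move=> FF Fc.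
have c1 : cvg ((fun u : S => u.1) @ F) by exact: cauchy_map Fc.
have c2 : cvg ((fun u : S => u.2) @ F) by exact: cauchy_map Fc.
apply/cvg_ex.
exists ((lim ((fun u : S => u.1) @ F), lim ((fun u : S => u.2) @ F)) : S).
apply/fcvgrPdist_lt => e e0.
move/cvgrPdist_lt : c1 => /(_ (e / 2)); rewrite divr_gt0// => /(_ isT) c1.
move/cvgrPdist_lt : c2 => /(_ (e / 2)); rewrite divr_gt0// => /(_ isT) c2.
near=> u; apply: le_lt_trans (ler_hsum_norm _) _.
by rewrite (splitr e) ltrD//=; near: u.
Unshelve. all: by end_near. Qed.

HB.instance Definition _ := Uniform_isComplete.Build S hsum_complete.

Definition hsum_inner (u v : S) : C := '[u.1, v.1] + '[u.2, v.2].

Fact hsum_inner_bilinear :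
  bilinear_for (GRing.Scale.Law.clone _ _ *%R _)
   (GRing.Scale.Law.clone _ _ (Num.conj \; *%R) _) hsum_inner.
Proof.
split=> [v|v] a x y; rewrite /hsum_inner /=.
  by rewrite !linearPl /= mulrDr addrACA.
by rewrite !linearPr /= mulrDr addrACA.
Qed.

HB.instance Definition _ := bilinear_isBilinear.Build C S S C *%R
  (Num.conj \; *%R) hsum_inner hsum_inner_bilinear.

Fact hsum_inner_herm (x y : S) :
  hsum_inner x y = (-1) ^+ false * (hsum_inner y x)^*.
Proof.
rewrite /hsum_inner rmorphD mulrDr; congr (_ + _); exact: hermC.
Qed.

HB.instance Definition _ :=
  isHermitianSesquilinear.Build C S false Num.conj hsum_inner hsum_inner_herm.

Fact hsum_normr_inner (x : S) : `|x| ^+ 2 = hsum_inner x x.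
Proof. by rewrite sqr_hsum_norm !normr_inner. Qed.

Fact hsum_inner_gt0 (x : S) : x != 0 -> 0 < hsum_inner x x.
Proof. by move=> x0; rewrite -hsum_normr_inner exprn_gt0// normr_gt0. Qed.

HB.instance Definition _ := isDotProduct.Build C S hsum_inner hsum_inner_gt0.

HB.instance Definition _ :=
  CompleteNormedModule_isHilbert.Build R S hsum_normr_inner.

End HilbertSum.

(* A relation from U to V is a set of pairs; U * V carries the product topology,
   which is also that of the Hilbert space sum. *)
Section LinearRelations.
Context {R : realType}.
Local Notation C := R[i].

Definition linear_relation (U V : lmodType C) (T : set (U * V)) : Prop :=
  T (0, 0) /\ forall (a : C) (u v : U * V), T u -> T v -> T (a *: u + v).

Definition rdom (U V : Type) (T : set (U * V)) : set U :=
  [set x | exists y, T (x, y)].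

Definition rran (U V : Type) (T : set (U * V)) : set V :=
  [set y | exists x, T (x, y)].

Definition rker (U : Type) (V : lmodType C) (T : set (U * V)) : set U :=
  [set x | T (x, 0)].

Definition op_graph (U V : Type) (f : U -> V) : set (U * V) :=
  [set u | u.2 = f u.1].

Definition adjoint (U V : hilbertType R) (T : set (U * V)) : set (V * U) :=
  [set v | forall u, T u -> '[u.2, v.1] = '[u.1, v.2]].

Definition symmetric_relation (H : hilbertType R) (T : set (H * H)) : Prop :=
  T `<=` adjoint T.

Definition selfadjoint_relation (H : hilbertType R) (T : set (H * H)) : Prop :=
  T = adjoint T.

Definition closed_symmetric_relation (H : hilbertType R) (T : set (H * H)) :
    Prop :=
  [/\ linear_relation T, closed T & symmetric_relation T].

Definition closed_symmetric_operator (H : hilbertType R) (T : set (H * H)) :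
    Prop :=
  closed_symmetric_relation T /\ forall y, T (0, y) -> y = 0.

(* {f1, f1'} (+) {f2, f2'} = {f1 (+) f2, f1' (+) f2'} *)
Definition osum (H1 H2 : hilbertType R) (u1 : H1 * H1) (u2 : H2 * H2) :
    hsum H1 H2 * hsum H1 H2 :=
  ((u1.1, u2.1), (u1.2, u2.2)).

End LinearRelations.

Section BoundedOperators.
Context {R : realType}.
Local Notation C := R[i].

Definition bounded_operator (H : hilbertType R) (T : {linear H -> H}) : Prop :=
  exists c : C, forall x, `|T x| <= c * `|x|.

(* K = T^-1 is bounded and everywhere defined: 0 belongs to the resolvent set
   of T. *)
Definition bounded_inverse (H : hilbertType R) (T : H -> H)
    (K : {linear H -> H}) : Prop :=
  [/\ bounded_operator K, cancel T K & cancel K T].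

Definition holomorphic_on (H : hilbertType R) (D : set C)
    (F : C -> {linear H -> H}) : Prop :=
  forall z, D z -> exists dF : {linear H -> H}, bounded_operator dF /\
    forall e : C, 0 < e -> \forall h \near (0 : C^o)^',
      forall x : H, `|h^-1 *: (F (z + h) x - F z x) - dF x| <= e * `|x|.

Definition nonreal : set C := [set z | 'Im z != 0].

(* The half-plane, C_+ or C_-, containing the nonreal number m. *)
Definition half_plane (m : C) : set C := [set z | 0 < 'Im z * 'Im m].

End BoundedOperators.

Section DefectNumbers.
Context {R : realType}.
Local Notation C := R[i].

Definition orthonormal_basis (H : hilbertType R) (N B : set H) : Prop :=
  [/\ B `<=` N,
      forall b, B b -> '[b, b] = 1,
      forall b c, B b -> B c -> b <> c -> '[b, c] = 0 &
      forall x, N x -> (forall b, B b -> '[x, b] = 0) -> x = 0].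

(* Equality of Hilbert space dimensions. *)
Definition same_dim (H K : hilbertType R) (N : set H) (N' : set K) : Prop :=
  exists (B : set H) (B' : set K),
    [/\ orthonormal_basis N B, orthonormal_basis N' B' & (B #= B')%card].

Definition defect_subspace (H : hilbertType R) (A : set (H * H)) (z : C) :
    set H :=
  [set f | adjoint A (f, z *: f)].

(* n_+(A) = n_-(A); n_+-(A) is the dimension of the defect subspace at any
   point of C_+-, here +-i. *)
Definition equal_defect_numbers (H : hilbertType R) (A : set (H * H)) : Prop :=
  same_dim (defect_subspace A 'i) (defect_subspace A (- 'i)).

End DefectNumbers.

Section BoundaryTriplets.
Context {R : realType} (H1 H : hilbertType R).
Local Notation C := R[i].

(* G : H1 * H1 -> H stands for an operator defined on A^*: its values outside
   the adjoint of A are irrelevant. *)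
Definition bounded_on_adjoint (A : set (H1 * H1)) (G : H1 * H1 -> H) : Prop :=
  (forall (a : C) u v, adjoint A u -> adjoint A v ->
     G (a *: u + v) = a *: G u + G v) /\
  exists c : C, forall u, adjoint A u ->
     `|G u| <= c * sqrtC (`|u.1| ^+ 2 + `|u.2| ^+ 2).

Definition boundary_triplet (A : set (H1 * H1)) (G0 G1 : H1 * H1 -> H) :
    Prop :=
  [/\ same_dim [set: H] (defect_subspace A 'i) /\
      same_dim [set: H] (defect_subspace A (- 'i)),
      bounded_on_adjoint A G0 /\ bounded_on_adjoint A G1,
      forall u v, adjoint A u -> adjoint A v ->
        '[u.2, v.1] - '[u.1, v.2] = '[G1 u, G0 v] - '[G0 u, G1 v] &
      forall h h' : H, exists u, [/\ adjoint A u, G0 u = h & G1 u = h']].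

Definition triplet_weyl_function (A : set (H1 * H1)) (G0 G1 : H1 * H1 -> H)
    (M : C -> {linear H -> H}) : Prop :=
  forall z, nonreal z -> bounded_operator (M z) /\
    forall f, adjoint A (f, z *: f) ->
      G1 (f, z *: f) = M z (G0 (f, z *: f)).

End BoundaryTriplets.

Section BoundaryRelations.
Context {R : realType} (H K : hilbertType R).
Local Notation C := R[i].

Definition green_identity (u v : (H * H) * (K * K)) : Prop :=
  '[u.1.2, v.1.1] - '[u.1.1, v.1.2] = '[u.2.2, v.2.1] - '[u.2.1, v.2.2].

Definition boundary_relation (S : set (H * H)) (G : set ((H * H) * (K * K))) :
    Prop :=
  [/\ closed_symmetric_relation S,
      linear_relation G,
      rdom G `<=` adjoint S /\ adjoint S `<=` closure (rdom G),
      forall u v, G u -> G v -> green_identity u v &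
      forall v, (forall u, G u -> green_identity u v) -> G v].

Definition weyl_family (G : set ((H * H) * (K * K))) (z : C) : set (K * K) :=
  [set h | exists f : H, G ((f, z *: f), h)].

Definition gamma0 (G : set ((H * H) * (K * K))) : set ((H * H) * K) :=
  [set u | exists h' : K, G (u.1, (u.2, h'))].

Definition condition_B1 (G : set ((H * H) * (K * K))) : Prop :=
  forall u v, G u -> G v -> green_identity u v.

Definition condition_B2 (G : set ((H * H) * (K * K))) : Prop :=
  rran (gamma0 G) = [set: K].

Definition condition_B3 (G : set ((H * H) * (K * K))) : Prop :=
  selfadjoint_relation (rker (gamma0 G)).

End BoundaryRelations.

Section NevanlinnaFamilies.
Context {R : realType} (H : hilbertType R).
Local Notation C := R[i].

Definition dissipative (T : set (H * H)) : Prop :=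
  forall u, T u -> 0 <= 'Im '[u.2, u.1].

Definition accumulative (T : set (H * H)) : Prop :=
  forall u, T u -> 'Im '[u.2, u.1] <= 0.

Definition maximal_relation (P : set (H * H) -> Prop) (T : set (H * H)) :
    Prop :=
  [/\ linear_relation T, P T &
      forall T', linear_relation T' -> P T' -> T `<=` T' -> T' = T].

Definition nevanlinna_family (tau : C -> set (H * H)) : Prop :=
  [/\ forall z, 0 < 'Im z -> maximal_relation dissipative (tau z),
      forall z, 'Im z < 0 -> maximal_relation accumulative (tau z),
      forall z, nonreal z -> adjoint (tau z) = tau z^* &
      forall m, nonreal m -> exists Res : C -> {linear H -> H},
        (forall z, half_plane m z -> bounded_operator (Res z) /\
           [set (u.2 + m *: u.1, u.1) | u in tau z] = op_graph (Res z)) /\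
        holomorphic_on (half_plane m) Res].

(* The conditions on Im (Phi(z)^* Psi(z)) / Im z and on
   Psi(conj z)^* Phi(z) - Phi(conj z)^* Psi(z) are written as forms, with the
   adjoints moved to the other side of the inner product. *)
Definition nevanlinna_pair (Phi Psi : C -> {linear H -> H}) : Prop :=
  [/\ forall z, nonreal z ->
        bounded_operator (Phi z) /\ bounded_operator (Psi z),
      holomorphic_on nonreal Phi /\ holomorphic_on nonreal Psi,
      forall z, nonreal z -> forall h, 0 <= 'Im '[Psi z h, Phi z h] / 'Im z,
      forall z, nonreal z -> forall h k,
        '[Phi z h, Psi z^* k] - '[Psi z h, Phi z^* k] = 0 &
      (forall z, 0 < 'Im z -> exists K,
         bounded_inverse (fun h => Psi z h + 'i *: Phi z h) K) /\
      (forall z, 'Im z < 0 -> exists K,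
         bounded_inverse (fun h => Psi z h - 'i *: Phi z h) K)].

Definition pair_relation (Phi Psi : {linear H -> H}) : set (H * H) :=
  [set (Phi h, Psi h) | h in [set: H]].

End NevanlinnaFamilies.

Section Couplings.
Context {R : realType} {H1 H2 H : hilbertType R}.
Variables (A : set (H1 * H1)) (G0 G1 : H1 * H1 -> H).
Variable (chi : set ((H2 * H2) * (H * H))).
Local Notation W := (hsum H1 H2).

Definition coupling_H1 : set (W * W) :=
  [set w | exists u1 u2, [/\ w = osum u1 u2,
     adjoint A u1 /\ rdom chi u2,
     G0 u1 = 0 &
     chi (u2, (0, - G1 u1))]].

Definition coupling_Gamma1 : set ((W * W) * (H * H)) :=
  [set w | exists u1 u2 h', [/\
     w = (osum u1 u2, (G1 u1 + h', - G0 u1)),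
     adjoint A u1 &
     chi (u2, (G0 u1, h'))]].

Definition coupling_H2 : set (W * W) :=
  [set w | exists u1 u2, [/\ w = osum u1 u2,
     adjoint A u1 /\ rdom chi u2,
     G1 u1 = 0 &
     chi (u2, (G0 u1, 0))]].

Definition coupling_Gamma2 : set ((W * W) * (H * H)) :=
  [set w | exists u1 u2 h, [/\
     w = (osum u1 u2, (- G0 u1 + h, - G1 u1)),
     adjoint A u1 &
     chi (u2, (h, - G1 u1))]].

End Couplings.

(* Main.v *)
From HB Require Import structures.
Require Import Defs.
From mathcomp Require Import all_boot all_order all_algebra.
From mathcomp Require Import ring complex sesquilinear.
From mathcomp Require Import all_classical all_reals all_analysis.

Set Implicit Arguments.
Unset Strict Implicit.
Unset Printing Implicit Defensive.

Import Order.TTheory GRing.Theory Num.Theory.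
Import numFieldNormedType.Exports.

Local Open Scope classical_set_scope.
Local Open Scope ring_scope.

(** Write [u, v] = (u', v) - (u, v') for the boundary form of two pairs.  Green's
identity together with maximality (conditions (G1) and (G2)) says that a
boundary relation G equals its own orthogonal companion: v belongs to G exactly
when the boundary forms of v and u on both sides of G agree for every u in G.
Such a G is called unitary here.  The proof has three ingredients.

Unitarity alone gives a boundary relation (unitary_boundary_relation): testing
against all u in G shows that ker G is the adjoint of dom G, hence closed and
symmetric, and its adjoint is the biadjoint of dom G, that is, the closure of
dom G.  So (i) and (ii) reduce to the unitarity of the coupling, which is
algebra (coupling_Gamma1_unitary): the surjectivity of {Gamma0, Gamma1} lets one
prescribe the boundary values of the first component freely, so that Green's
identity against the coupling turns into Green's identity against chi.
Conditions (B2) and (B3) follow in the same way.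

If (B2) and (B3) hold, then the Weyl family has full domain at every nonreal z
(weyl_family_domain), because a selfadjoint relation minus z is surjective
(selfadjoint_resolvent_surjective).  For the boundary triplet this produces
defect elements with prescribed Gamma0; for the coupling it makes
Psi(z) + M(z) Phi(z) surjective, since the elements of its Weyl family are
exactly the pairs {(Psi + M Phi) k, - Phi k} (weyl_coupling_Gamma1).  Green's
identity of the coupling, applied to a defect element and itself, controls the
norm of the first component of that element, and hence Phi k, by
(Psi + M Phi) k; the Nevanlinna pair then controls k.  So Psi + M Phi is
boundedly invertible (coupling_bounded_inverse), and (iii) and (vi) are read off.

Statements (iv) and (v) are (i) and (ii) for the triplet {Gamma1, - Gamma0} and
for chi with its boundary values rotated (coupling_Gamma2_flip). *)

(** * Inner products and small norms *)

Section InnerProduct.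
Context {R : realType} (V : hilbertType R).
Local Notation C := R[i].
Implicit Types (u v w : V) (a : C).

Lemma innerDl u v w : '[u + v, w] = '[u, w] + '[v, w].
Proof. exact: linearDl. Qed.

Lemma innerDr u v w : '[u, v + w] = '[u, v] + '[u, w].
Proof. exact: linearDr. Qed.

Lemma innerNl u v : '[- u, v] = - '[u, v].
Proof. exact: linearNl. Qed.

Lemma innerNr u v : '[u, - v] = - '[u, v].
Proof. exact: linearNr. Qed.

Lemma innerZl a u v : '[a *: u, v] = a * '[u, v].
Proof. exact: linearZl_LR. Qed.

Lemma innerZr a u v : '[u, a *: v] = a^* * '[u, v].
Proof. exact: linearZr_LR. Qed.

Lemma inner0l v : '[0, v] = 0.
Proof. exact: linear0l. Qed.

Lemma inner0r u : '[u, 0] = 0.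
Proof. exact: linear0r. Qed.

Lemma innerC u v : '[u, v] = '[v, u]^*.
Proof. by rewrite hermC mul1r. Qed.

Definition innerE := (innerDl, innerDr, innerNl, innerNr, innerZl, innerZr,
  inner0l, inner0r).

Lemma sqr_normD_orthogonal u v :
  '[u, v] = 0 -> `|u + v| ^+ 2 = `|u| ^+ 2 + `|v| ^+ 2.
Proof.
by move=> uv; rewrite !normr_inner !innerE uv (innerC v u) uv rmorph0 addr0 add0r.
Qed.

(** The Cauchy-Schwarz inequality: u is split into its component along v
and an orthogonal remainder, and the norm of that component is |(u, v)| / |v|. *)
Lemma norm_inner_le u v : `|'[u, v]| <= `|u| * `|v|.
Proof.
have [->|v0] := eqVneq v 0; first by rewrite inner0r !normr0 mulr0.
have vv0 : '[v, v] != 0 by rewrite -normr_inner sqrf_eq0 normr_eq0.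
pose a := '[u, v] / '[v, v].
have uav : '[u - a *: v, a *: v] = 0.
  by rewrite innerZr !innerE /a divfK// subrr mulr0.
have : `|a *: v| <= `|u|.
  rewrite -(ler_pXn2r (ltn0Sn 1)) ?nnegrE// -[u in leRHS](subrK (a *: v)).
  by rewrite (sqr_normD_orthogonal uav) lerDr exprn_ge0.
rewrite normrZ => /(ler_wpM2r (normr_ge0 v)); apply: le_trans.
by rewrite -mulrA -expr2 normr_inner /a normrM normfV -normr_inner !normrX
  normr_id divfK// expf_neq0// normr_eq0.
Qed.

Lemma inner_eq0 v : '[v, v] = 0 -> v = 0.
Proof. by move/eqP; rewrite -normr_inner sqrf_eq0 normr_eq0 => /eqP. Qed.

(** Turns an identity between vectors into a scalar identity, to be settled by
ring or field. *)
Lemma inner_ext u v : (forall w, '[u, w] = '[v, w]) -> u = v.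
Proof.
by move=> uv; apply/subr0_eq/inner_eq0; rewrite {1}innerDl innerNl uv subrr.
Qed.

Lemma inner_eq0C u v : '[u, v] = 0 -> '[v, u] = 0.
Proof. by rewrite innerC => /(congr1 Num.conj); rewrite conjCK conjC0. Qed.

End InnerProduct.

Lemma norm_le_eps_eq0 (C : numFieldType) (U : normedZmodType C) (x : U) (c : C) :
  0 <= c -> (forall e, 0 < e -> `|x| <= e * c) -> x = 0.
Proof.
move=> c0 xc; apply/eqP; rewrite -normr_le0; apply/negPn/negP => x0.
have xp : 0 < `|x| by rewrite normr_gt0; apply: contra x0 => /eqP->; rewrite normr0.
have c1 : 0 < c + 1 by rewrite ltr_wpDl.
have := xc (`|x| / (c + 1)) (divr_gt0 xp c1).
rewrite -mulrA -subr_ge0 -{2}(mulr1 `|x|) -mulrBr pmulr_rge0//.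
rewrite -{2}(@divff _ (c + 1)) ?gt_eqF// [_^-1 * c]mulrC -mulrBl.
by rewrite opprD addrA subrr add0r mulN1r oppr_ge0 invr_le0 (lt_geF c1).
Qed.

Lemma inner_hsum (R : realType) (H1 H2 : hilbertType R) (u v : hsum H1 H2) :
  '[u, v] = '[u.1, v.1] + '[u.2, v.2].
Proof. by []. Qed.

(** * The projection theorem *)

Section Projection.
Context {R : realType} (V : hilbertType R).
Local Notation C := R[i].

Definition linear_set (T : set V) : Prop :=
  T 0 /\ forall (a : C) u v, T u -> T v -> T (a *: u + v).

(** Membership in the closure, stated with the norm.  On the Hilbert space sum
this norm induces the product topology, so approximability there gives
membership in the closure in the product. *)
Definition approximable (T : set V) (p : V) : Prop :=
  forall e : C, 0 < e -> exists2 t, T t & `|p - t| < e.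

Lemma parallelogram (u v : V) :
  `|u - v| ^+ 2 + `|u + v| ^+ 2 = 2 * `|u| ^+ 2 + 2 * `|v| ^+ 2.
Proof. by rewrite !normr_inner !innerE; ring. Qed.

Lemma real_part_gt0 (e : C) : 0 < e -> exists2 r : R, 0 < r & e = r%:C%C.
Proof.
case: e => a b; rewrite ltcE /= => /andP[/eqP-> a0]; by exists a.
Qed.

(** Norms take values in the partially ordered field of complex numbers, so the
infimum is taken over the real numbers and transported back. *)
Lemma distance_inf (T : set V) (x : V) : T !=set0 ->
  exists d : C, (forall t, T t -> d <= `|x - t| ^+ 2) /\
    forall e, 0 < e -> exists2 t, T t & `|x - t| ^+ 2 < d + e.
Proof.
move=> [t0 Tt0].
have sqr t : exists r : R, 0 <= r /\ `|x - t| ^+ 2 = r%:C%C.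
  have : 0 <= `|x - t| ^+ 2 by rewrite exprn_ge0.
  rewrite le_eqVlt => /predU1P[<-|/real_part_gt0[r r0 ->]]; first by exists 0.
  by exists r; split=> //; exact: ltW.
pose E := [set r : R | exists2 t, T t & `|x - t| ^+ 2 = r%:C%C].
have E0 : lbound E 0.
  by move=> r [t Tt rE]; rewrite -ler0c -rE exprn_ge0.
have infE : has_inf E.
  by split; [have [r [_ rE]] := sqr t0; exists r, t0 | exists 0].
exists (inf E)%:C%C; split=> [t Tt|e /real_part_gt0[r r0 ->]].
  have [r [_ rE]] := sqr t; rewrite rE lecR; apply: ge_inf; first by exists 0.
  by exists t.
have [s [t Tt tE] sr] := inf_adherent r0 infE.
by exists t => //; rewrite tE -rmorphD ltcR.
Qed.

(** The parallelogram law for x - s and x - t, whose half sum x - (s + t) / 2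
is again at squared distance at least d. *)
Lemma near_minimizer_close (T : set V) (x s t : V) (d e : C) : linear_set T ->
  (forall w, T w -> d <= `|x - w| ^+ 2) -> T s -> T t ->
  `|x - s| ^+ 2 < d + e -> `|x - t| ^+ 2 < d + e ->
  `|s - t| ^+ 2 < 4 * e.
Proof.
move=> [T0 Tl] dP Ts Tt se te.
have Tm : T (2^-1 *: (s + t)).
  rewrite -[_ *: _]addr0; apply: (Tl) => //.
  by rewrite -[s]scale1r; exact: Tl.
have mE : (x - s) + (x - t) = (2 : C) *: (x - 2^-1 *: (s + t)).
  rewrite scalerBr scalerA divff ?pnatr_eq0// scale1r addrACA -opprD.
  by rewrite scaler_nat mulr2n.
have := parallelogram (x - t) (x - s).
rewrite [X in `|X| ^+ 2 + _](_ : _ = s - t); last by rewrite opprB addrC subrKA.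
rewrite [x - t + _]addrC mE normrZ exprMn => /(canRL (addrK _)) ->.
rewrite ger0_norm//; have := dP _ Tm.
move: (`|x - _ *: _| ^+ 2) (`|x - s| ^+ 2) (`|x - t| ^+ 2) se te => m a b ad bd dm.
rewrite -subr_gt0.
have -> : 4 * e - (2 * b + 2 * a - 2 ^+ 2 * m) =
    2 * (d + e - a) + 2 * (d + e - b) + 4 * (m - d) by ring.
by rewrite ltr_wpDr ?mulr_ge0 ?subr_ge0// addr_gt0 ?mulr_gt0 ?subr_gt0.
Qed.

(** Moving s along the projection of x - s on the line through t lowers the
squared distance by |(x - s, t)|^2 / |t|^2, which must stay below e^2. *)
Lemma near_minimizer_orthogonal (T : set V) (x s t : V) (d e : C) :
  linear_set T -> (forall w, T w -> d <= `|x - w| ^+ 2) -> T s -> T t ->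
  `|x - s| ^+ 2 < d + e ^+ 2 -> 0 < e -> `|'[x - s, t]| <= e * `|t|.
Proof.
move=> [T0 Tl] dP Ts Tt se e0.
have [->|t0] := eqVneq t 0; first by rewrite inner0r normr0 mulr_ge0// ltW.
have n0 : 0 < `|t| by rewrite normr_gt0.
have tt0 : '[t, t] != 0 by rewrite -normr_inner expf_neq0// gt_eqF.
pose a := '[x - s, t] / '[t, t].
have at0 : '[x - s - a *: t, a *: t] = 0.
  by rewrite innerZr [X in _ * X]innerDl innerNl innerZl /a divfK// subrr mulr0.
have := sqr_normD_orthogonal at0; rewrite subrK => xsE.
have Tas : T (a *: t + s) by exact: Tl.
have := dP _ Tas; rewrite opprD addrA addrAC => dle.
have ate : `|a *: t| <= e.
  rewrite -(@ler_pXn2r _ 2) ?nnegrE ?(ltW e0)// ltW// -(ltrD2l d).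
  by apply: le_lt_trans se; rewrite xsE lerD2r.
apply: le_trans (ler_wpM2r (ltW n0) ate).
by rewrite normrZ -mulrA -expr2 normr_inner /a normrM normfV -normr_inner
  !normrX normr_id divfK// expf_neq0// gt_eqF.
Qed.

Lemma approximable_orthogonal (T : set V) (p r : V) :
  approximable T p -> (forall t, T t -> '[t, r] = 0) -> '[p, r] = 0.
Proof.
move=> pT rT; apply: (@norm_le_eps_eq0 _ _ _ `|r|) => // e /pT[t Tt pt].
rewrite -['[p, r]]subr0 -(rT t Tt) -innerNl -innerDl.
by rewrite (le_trans (norm_inner_le _ _))// ler_wpM2r// ltW.
Qed.

(** The nearly minimizing elements of T form a Cauchy filter, by the parallelogram
law; its limit p lies in the closure of T. *)
Theorem orthogonal_projection (T : set V) (x : V) : linear_set T ->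
  exists2 p, approximable T p & forall t, T t -> '[x - p, t] = 0.
Proof.
move=> Tl; have T0 : T !=set0 by exists 0; exact: Tl.1.
have [d [dP infP]] := distance_inf x T0.
pose B (e : C) := [set t | T t /\ `|x - t| ^+ 2 < d + e].
pose F := filter_from [set e : C | 0 < e] B.
have FF : Filter F.
  apply: filter_from_filter; first by exists 1; exact: ltr01.
  have mono (a b : C) : a <= b -> B a `<=` B a `&` B b.
    by move=> ab t [Tt ta]; do 2!split=> //; apply: lt_le_trans ta _; rewrite lerD2l.
  move=> a b a0 b0.
  have /orP[ab|ba] := real_leVge (gtr0_real a0) (gtr0_real b0).
    by exists a => //; exact: mono.
  by exists b => // t /mono-/(_ _ ba)[].
have PF : ProperFilter F.
  apply: filter_from_proper => e e0; have [t Tt te] := infP e e0; by exists t.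
have Fc : cauchy F.
  apply: cauchy_exP => e e0.
  have e2 : 0 < e ^+ 2 / 4 by rewrite divr_gt0// exprn_gt0.
  have [s Ts se] := infP _ e2; exists s; exists (e ^+ 2 / 4) => // t [Tt te].
  rewrite -ball_normE /ball_/= -(@ltr_pXn2r _ 2)// ?nnegrE// ?ltW//.
  have := near_minimizer_close Tl dP Ts Tt se te.
  by rewrite [4 * _]mulrC divfK ?pnatr_eq0.
have /cauchy_cvg/cvg_ex[p Fp] := Fc.
have near_p e : 0 < e ->
    exists s, [/\ T s, `|p - s| < e & `|x - s| ^+ 2 < d + e ^+ 2].
  move=> e0; move/fcvgrPdist_lt : Fp => /(_ e e0) pe.
  have se : F (B (e ^+ 2)) by exists (e ^+ 2) => //; exact: exprn_gt0.
  by have [s [ps [Ts xs]]] := filter_ex (filterI pe se); exists s.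
exists p => [e /near_p[s [Ts ps _]]|t Tt]; first by exists s.
apply: (@norm_le_eps_eq0 _ _ _ (2 * `|t|)) => [|e e0]; first by rewrite mulr_ge0.
have [s [Ts ps xs]] := near_p e e0.
rewrite -(subrKA s x (- p)) innerDl (le_trans (ler_normD _ _))//.
rewrite mulrCA mulr_natl mulr2n lerD//.
  exact: near_minimizer_orthogonal Tl dP Ts Tt xs e0.
by rewrite (le_trans (norm_inner_le _ _))// ler_wpM2r// distrC ltW.
Qed.

End Projection.

(** * Adjoints of linear relations *)

Section BoundaryForm.
Context {R : realType} (V : hilbertType R).
Local Notation C := R[i].
Implicit Types (u v w : V * V) (T : set (V * V)) (a : C).

Definition boundary_form u v : C := '[u.2, v.1] - '[u.1, v.2].

Lemma boundary_formDr u v w :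
  boundary_form u (v + w) = boundary_form u v + boundary_form u w.
Proof. by rewrite /boundary_form /= !innerDr opprD addrACA. Qed.

Lemma boundary_formZr a u v : boundary_form u (a *: v) = a^* * boundary_form u v.
Proof. by rewrite /boundary_form /= !innerZr mulrBr. Qed.

Lemma boundary_form0l v : boundary_form 0 v = 0.
Proof. by rewrite /boundary_form /= !inner0l subrr. Qed.

Lemma boundary_form0r u : boundary_form u 0 = 0.
Proof. by rewrite /boundary_form /= !inner0r subrr. Qed.

Lemma boundary_formC u v : boundary_form v u = - (boundary_form u v)^*.
Proof. by rewrite /boundary_form rmorphB /= -!innerC opprB. Qed.

Lemma boundary_form_le u v :
  `|boundary_form u v| <= `|u.2| * `|v.1| + `|u.1| * `|v.2|.
Proof. by apply: le_trans (ler_normB _ _) (lerD _ _); exact: norm_inner_le. Qed.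

(** Combined with Green's identity, this recovers the norm of a defect element
from its boundary values. *)
Lemma boundary_form_eigen (z : C) (f : V) :
  boundary_form (f, z *: f) (f, z *: f) = (z - z^*) * `|f| ^+ 2.
Proof. by rewrite /boundary_form innerZl innerZr -mulrBl normr_inner. Qed.

Lemma adjointP T v : adjoint T v <-> forall u, T u -> boundary_form u v = 0.
Proof.
split=> Tv u /Tv; first by move=> h; rewrite /boundary_form h subrr.
by move/eqP; rewrite subr_eq0 => /eqP.
Qed.

Lemma adjoint_linear T : linear_relation (adjoint T).
Proof.
split; first by apply/adjointP => u _; exact: boundary_form0r.
move=> a u v /adjointP Tu /adjointP Tv; apply/adjointP => w Tw.
by rewrite boundary_formDr boundary_formZr Tu// Tv// mulr0 addr0.
Qed.

Lemma closure_pairP T v : closure T v <->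
  forall e : C, 0 < e -> exists t, [/\ T t, `|v.1 - t.1| < e & `|v.2 - t.2| < e].
Proof.
split=> [Tv e e0|Tv B /nbhs_ballP[e e0 eB]].
  have [t [Tt vt]] := Tv _ (nbhsx_ballx v e e0); exists t.
  by move: vt => [] /=; rewrite -!ball_normE.
have [t [Tt t1 t2]] := Tv e e0; exists t; split=> //.
by apply: eB; split; rewrite -ball_normE.
Qed.

Lemma adjoint_closed T : closed (adjoint T).
Proof.
move=> v /closure_pairP Tv; apply/adjointP => u Tu.
apply: (@norm_le_eps_eq0 _ _ _ (`|u.2| + `|u.1|)) => [|e /Tv[t [/adjointP Tt t1 t2]]].
  by rewrite addr_ge0.
have -> : boundary_form u v = boundary_form u (v - t).
  rewrite -[v in LHS](subrK t) [LHS]boundary_formDr.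
  by rewrite Tt// addr0.
rewrite (le_trans (boundary_form_le _ _))// mulrDr.
by rewrite lerD// mulrC ler_wpM2r// ltW.
Qed.

Lemma norm_fst_le (u : hsum V V) : `|u.1| <= `|u|.
Proof.
rewrite -(@ler_pXn2r _ 2) ?nnegrE// !normr_inner.
by rewrite lerDl -normr_inner exprn_ge0.
Qed.

Lemma norm_snd_le (u : hsum V V) : `|u.2| <= `|u|.
Proof.
rewrite -(@ler_pXn2r _ 2) ?nnegrE// !normr_inner.
by rewrite lerDr -normr_inner exprn_ge0.
Qed.

(** Let p be the projection of v on T in the Hilbert space sum.  The remainder
q = v - p, rotated by a quarter turn, lies in the adjoint of T; so q is
orthogonal to v, to p and finally to itself. *)
Lemma biadjoint_closure T : linear_relation T ->
  adjoint (adjoint T) `<=` closure T.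
Proof.
move=> Tl v /adjointP TTv.
have [p pT pperp] := @orthogonal_projection _ (hsum V V) T v Tl.
pose q := (v : hsum V V) - p.
have Tq : adjoint T (q.2, - q.1).
  apply/adjointP => u Tu; rewrite /boundary_form /= innerNr opprK addrC.
  exact: (inner_eq0C (pperp u Tu)).
have qv : '[q, v : hsum V V] = 0.
  have := TTv _ Tq; rewrite /boundary_form /= innerNl -opprD => /eqP.
  by rewrite oppr_eq0 => /eqP.
have qp : '[q, p] = 0.
  by apply/inner_eq0C/(approximable_orthogonal pT) => t /pperp/inner_eq0C.
have /inner_eq0/subr0_eq vp : '[q, q] = 0.
  by rewrite {2}/q innerDr innerNr qv qp subrr.
apply/closure_pairP => e /pT[t Tt pt]; exists t.
split=> //; apply: le_lt_trans pt; rewrite vp.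
  exact: (norm_fst_le (p - t)).
exact: (norm_snd_le (p - t)).
Qed.

(** Let z = a + i b.  The relation S of the pairs {b f, f' - a f}, {f, f'} in T,
is (T - a) / b and again selfadjoint.  Decompose (0, y) into
p in the closure of S and q orthogonal to S.  By selfadjointness p and q both
come from elements of T, and the two combine, with coefficient i / b, to the
solution. *)
Theorem selfadjoint_resolvent_surjective T (z : C) (y : V) :
  selfadjoint_relation T -> nonreal z -> exists2 u, T u & u.2 - z *: u.1 = y.
Proof.
move=> Tsa; rewrite /nonreal /= => z0.
have Tl : linear_relation T by rewrite Tsa; exact: adjoint_linear.
pose a := 'Re z; pose b := 'Im z.
have aJ : a^* = a by apply/CrealP; exact: Creal_Re.
have bJ : b^* = b by apply/CrealP; exact: Creal_Im.
pose S : set (hsum V V) := [set (b *: u.1, u.2 - a *: u.1) | u in T].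
have Sl : linear_set S.
  case: Tl => T0 Tl; split.
    by exists 0 => //=; rewrite !scaler0 subr0.
  move=> c _ _ [u Tu <-] [v Tv <-]; exists (c *: u + v); first exact: Tl.
  congr pair => /=; first by rewrite scalerDr !scalerA mulrC.
  by rewrite scalerBr scalerDr opprD addrACA !scalerA [a * c]mulrC.
have [p pS pperp] := @orthogonal_projection _ (hsum V V) S (0, y) Sl.
pose q := ((0, y) : hsum V V) - p.
(* Orthogonality to S is membership of a rotation of q in the adjoint of T. *)
have Tq : T (q.2, a *: q.2 - b *: q.1).
  rewrite Tsa; apply/adjointP => u Tu.
  have Su : S (b *: u.1, u.2 - a *: u.1) by exists u.
  have := inner_eq0C (pperp _ Su); rewrite -/q inner_hsum /= => <-.
  by rewrite /boundary_form /= !innerE aJ bJ; ring.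
(* Selfadjointness makes membership in T an orthogonality relation, which passes
   from the elements of S to their limit p. *)
have Tp : T (b^-1 *: p.1, p.2 + (a / b) *: p.1).
  rewrite Tsa; apply/adjointP => u Tu.
  have : '[p, ((b^-1 *: u.2 - (a / b) *: u.1, - u.1) : hsum V V)] = 0.
    apply: (approximable_orthogonal pS) => _ [v Tv <-].
    have /adjointP/(_ v Tv) vu : adjoint T u by rewrite -Tsa.
    rewrite -[RHS]oppr0 -vu inner_hsum /boundary_form /= !innerE.
    by rewrite rmorphM !fmorphV /= aJ bJ; field.
  move=> /inner_eq0C; rewrite inner_hsum /boundary_form /= => <-.
  by rewrite !innerE rmorphM !fmorphV /= aJ bJ; ring.
(* The coefficient c solves c (a - z) = 1 and c b^2 = i b: then q.2 gets the
   factor 1 and p.1 cancels. *)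
pose c := 'i / b.
exists (c *: (q.2, a *: q.2 - b *: q.1) + (b^-1 *: p.1, p.2 + (a / b) *: p.1)).
  by case: Tl => _; exact.
apply: inner_ext => w; rewrite /= sub0r !innerE.
rewrite {1}(Crect z) -/a -/b /c.
have i2 : 'i * 'i = -1 :> C by rewrite -expr2 sqrCi.
by field: i2.
Qed.

End BoundaryForm.

(** * Unitary relations are boundary relations *)

Section UnitaryRelations.
Context {R : realType} (V K : hilbertType R).
Local Notation C := R[i].
Implicit Types (G : set ((V * V) * (K * K))).

(** Unitarity between the Krein spaces defined by the two boundary forms. *)
Definition unitary_relation G : Prop :=
  forall v, G v <-> forall u, G u -> green_identity u v.

Lemma green_identityE (u v : (V * V) * (K * K)) :
  green_identity u v <-> boundary_form u.1 v.1 = boundary_form u.2 v.2.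
Proof. by []. Qed.

Lemma boundary_relation_unitary (S : set (V * V)) G :
  boundary_relation S G -> unitary_relation G.
Proof. by case=> _ _ _ B1 max v; split=> [Gv u Gu|]; [exact: B1 | exact: max]. Qed.

Lemma unitary_linear G : unitary_relation G -> linear_relation G.
Proof.
move=> GU; split.
  by apply/GU => u _; apply/green_identityE; rewrite !boundary_form0r.
move=> a u v /GU Gu /GU Gv; apply/GU => w Gw; apply/green_identityE.
move/Gu/green_identityE : (Gw) => wu; move/Gv/green_identityE : (Gw) => wv.
by rewrite !boundary_formDr !boundary_formZr wu wv.
Qed.

(** For a pair with vanishing boundary values the defining condition of
unitarity reduces to orthogonality to dom G in the boundary form. *)
Lemma unitary_rker G : unitary_relation G -> rker G = adjoint (rdom G).
Proof.
move=> GU; apply/seteqP; split=> [v /= Gv|v /adjointP Gv].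
  apply/adjointP => u [h Gu]; move/GU : Gv => /(_ _ Gu)/green_identityE /= ->.
  exact: boundary_form0r.
apply/GU => -[u h] Gu; apply/green_identityE.
by rewrite boundary_form0r Gv//; exists h.
Qed.

Theorem unitary_boundary_relation G : unitary_relation G ->
  boundary_relation (rker G) G.
Proof.
move=> GU; have [G0 Gl] := unitary_linear GU.
have domG : linear_relation (rdom G).
  split=> [|a u v [h Gu] [k Gv]]; first by exists 0.
  by exists (a *: h + k); exact: (Gl a (u, h) (v, k)).
have kerG := unitary_rker GU.
split; last 2 first.
- by move=> u v Gu /GU; exact.
- by move=> v /GU.
- split; rewrite ?kerG; [exact: adjoint_linear | exact: adjoint_closed |].
  rewrite -kerG => u Gu; apply/adjointP => v Gv.
  by move/GU : Gu => /(_ _ Gv)/green_identityE /= ->; exact: boundary_form0r.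
- by split=> // a u v; exact: Gl.
- rewrite kerG; split; last exact: biadjoint_closure.
  move=> u Gu; apply/adjointP => v /adjointP/(_ u Gu) uv.
  by rewrite boundary_formC uv conjC0 oppr0.
Qed.

(** By (B2) some u has boundary value h; by (B3) the range of ker Gamma0 minus z
is everything, so subtracting an element of ker Gamma0 makes u a defect element
without changing h. *)
Theorem weyl_family_domain G (z : C) (h : K) : linear_relation G ->
  condition_B2 G -> condition_B3 G -> nonreal z ->
  exists f h', G ((f, z *: f), (h, h')).
Proof.
move=> [_ Gl] B2 B3 z0.
have [u [h' Guh]] : rran (gamma0 G) h by rewrite B2.
have [w [k Gwk] wE] :=
  selfadjoint_resolvent_surjective (u.2 - z *: u.1) B3 z0.
exists (u.1 - w.1), (h' - k).
have := Gl (-1) _ _ Gwk Guh; rewrite !scaleN1r.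
congr G; congr pair; last by congr pair; rewrite /= ?oppr0 ?add0r// addrC.
rewrite [LHS]surjective_pairing; congr pair; first by rewrite /= addrC.
rewrite /= (canRL (subrK _) (esym wE)) scalerBr.
by rewrite !addrA addNr add0r addrC.
Qed.

End UnitaryRelations.

(** * Ordinary boundary triplets *)

Section BoundaryTriplets.
Context {R : realType} (H1 H : hilbertType R).
Local Notation C := R[i].
Variables (A : set (H1 * H1)) (G0 G1 : H1 * H1 -> H).
Hypothesis symA : symmetric_relation A.
Hypothesis triplet : boundary_triplet A G0 G1.

Lemma triplet_linear (a : C) u v : adjoint A u -> adjoint A v ->
  G0 (a *: u + v) = a *: G0 u + G0 v /\ G1 (a *: u + v) = a *: G1 u + G1 v.
Proof. by case: triplet => _ [[l0 _] [l1 _]] _ _ Au Av; rewrite l0// l1. Qed.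

Lemma triplet_green u v : adjoint A u -> adjoint A v ->
  boundary_form u v = '[G1 u, G0 v] - '[G0 u, G1 v].
Proof. by case: triplet => _ _ green _; exact: green. Qed.

Lemma triplet_surjective h h' : exists u, [/\ adjoint A u, G0 u = h & G1 u = h'].
Proof. by case: triplet. Qed.

(** Elements of A are orthogonal to the adjoint of A in the boundary form, while
the boundary values of the latter fill the whole of H x H. *)
Lemma triplet_minimal u : A u -> [/\ adjoint A u, G0 u = 0 & G1 u = 0].
Proof.
move=> Au; have Asu := symA Au.
have zero v : adjoint A v -> '[G1 v, G0 u] - '[G0 v, G1 u] = 0.
  move=> Av; rewrite -triplet_green// boundary_formC.
  by have /adjointP/(_ u Au) -> := Av; rewrite conjC0 oppr0.
split=> //.
  have [v [Av v0 v1]] := triplet_surjective 0 (G0 u).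
  by apply: inner_eq0; rewrite -(zero v Av) v0 v1 inner0l subr0.
have [v [Av v0 v1]] := triplet_surjective (- G1 u) 0.
by apply: inner_eq0; rewrite -(zero v Av) v0 v1 inner0l innerNl opprK add0r.
Qed.

(** The triplet as a relation, so that the results for boundary relations apply
to it. *)
Definition triplet_relation : set ((H1 * H1) * (H * H)) :=
  [set w | adjoint A w.1 /\ w.2 = (G0 w.1, G1 w.1)].

Lemma triplet_relation_linear : linear_relation triplet_relation.
Proof.
have [A0 Al] := adjoint_linear A; split.
  split=> //; have := triplet_linear (-1) A0 A0.
  by rewrite scaler0 addr0 !scaleN1r !addNr => -[/= -> ->].
move=> a [u h] [v k] [/= Au ->] [/= Av ->]; split=> /=; first exact: Al.
by have [-> ->] := triplet_linear a Au Av.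
Qed.

Lemma triplet_relation_B2 : condition_B2 triplet_relation.
Proof.
apply/seteqP; split=> // h _; have [u [Au u0 _]] := triplet_surjective h 0.
by exists u, (G1 u); split=> //=; rewrite u0.
Qed.

Lemma triplet_kernelP u :
  rker (gamma0 triplet_relation) u <-> adjoint A u /\ G0 u = 0.
Proof.
split=> [[h' [/= Au [<- _]]]//|[Au u0]].
by exists (G1 u); split=> //=; rewrite u0.
Qed.

Lemma triplet_relation_B3 : condition_B3 triplet_relation.
Proof.
apply/seteqP; split=> v.
  move=> /triplet_kernelP[Av v0]; apply/adjointP => u /triplet_kernelP[Au u0].
  by rewrite triplet_green// u0 v0 inner0l inner0r subrr.
move=> /adjointP kerv; apply/triplet_kernelP.
have Av : adjoint A v.
  apply/adjointP => u /triplet_minimal[Au u0 _]; apply: kerv.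
  exact/triplet_kernelP.
split=> //; have [u [Au u0 u1]] := triplet_surjective 0 (G0 v).
have : boundary_form u v = 0 by apply/kerv/triplet_kernelP.
by rewrite triplet_green// u0 u1 inner0l subr0 => /inner_eq0.
Qed.

Lemma triplet_defect_surjective (z : C) (h : H) : nonreal z ->
  exists f, adjoint A (f, z *: f) /\ G0 (f, z *: f) = h.
Proof.
move=> z0; have [f [h' [/= Af [hE _]]]] := weyl_family_domain h
  triplet_relation_linear triplet_relation_B2 triplet_relation_B3 z0.
by exists f.
Qed.

(** The boundedness of Gamma0 in the graph norm, which on the defect subspace is
a multiple of the norm. *)
Lemma triplet_defect_bounded (z : C) : exists2 c : C, 0 <= c &
  forall f, adjoint A (f, z *: f) ->
    `|G0 (f, z *: f)| ^+ 2 <= c * `|f| ^+ 2.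
Proof.
case: triplet => _ [[_ [c cP]] _] _ _.
exists (`|c| ^+ 2 * (1 + `|z| ^+ 2)) => [|f Af].
  by rewrite mulr_ge0 ?addr_ge0 ?exprn_ge0.
have := cP _ Af; rewrite /= normrZ exprMn -{1}(mul1r (`|f| ^+ 2)) -mulrDl.
set s := (1 + _) * _ => cs.
have s0 : 0 <= s by rewrite mulr_ge0 ?addr_ge0 ?exprn_ge0.
rewrite -mulrA -/s -(sqrtCK s) -exprMn ler_pXn2r ?nnegrE ?mulr_ge0 ?sqrtC_ge0//.
rewrite (le_trans cs)// -(ger0_norm (le_trans (normr_ge0 _) cs)) normrM.
by rewrite (@ger0_norm _ (sqrtC s)) ?sqrtC_ge0.
Qed.

End BoundaryTriplets.

(** * The coupling *)

Lemma boundary_triplet_flip (R : realType) (H1 H : hilbertType R)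
    (A : set (H1 * H1)) (G0 G1 : H1 * H1 -> H) :
  boundary_triplet A G0 G1 -> boundary_triplet A G1 (fun u => - G0 u).
Proof.
case=> dims [[l0 [c cP]] B1] green surj; split=> //.
- split=> //; split=> [a u v Au Av|]; first by rewrite l0// opprD scalerN.
  by exists c => u Au; rewrite normrN; exact: cP.
- by move=> u v Au Av; rewrite green// innerNl innerNr opprK addrC.
- move=> h h'; have [u [Au u0 u1]] := surj (- h') h.
  by exists u; rewrite u0 opprK.
Qed.

Section Couplings.
Context {R : realType} {H1 H2 H : hilbertType R}.
Local Notation C := R[i].
Local Notation W := (hsum H1 H2).

Lemma boundary_form_osum (u1 v1 : H1 * H1) (u2 v2 : H2 * H2) :
  boundary_form (osum u1 u2) (osum v1 v2) =
    boundary_form u1 v1 + boundary_form u2 v2.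
Proof. by rewrite /boundary_form /= !inner_hsum /= opprD addrACA. Qed.

Lemma osum_surj (w : W * W) : exists u1 u2, w = osum u1 u2.
Proof. by case: w => -[a b] [c d]; exists (a, c), (b, d). Qed.

Lemma osum_inj (u1 v1 : H1 * H1) (u2 v2 : H2 * H2) :
  osum u1 u2 = osum v1 v2 -> u1 = v1 /\ u2 = v2.
Proof. by case: u1 u2 v1 v2 => [a b] [c d] [a' b'] [c' d'] [-> -> -> ->]. Qed.

Variables (A : set (H1 * H1)) (G0 G1 : H1 * H1 -> H).
Variable (chi : set ((H2 * H2) * (H * H))).
Hypothesis symA : symmetric_relation A.
Hypothesis triplet : boundary_triplet A G0 G1.
Hypothesis chiU : unitary_relation chi.
Local Notation Gamma1 := (coupling_Gamma1 A G0 G1 chi).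

Let chi0 : chi (0, 0). Proof. exact: (unitary_linear chiU).1. Qed.

(** Orthogonality to D is a condition on v1 and v2 jointly; the elements osum u 0
isolate v1. *)
Lemma coupling_adjoint (v1 : H1 * H1) (v2 : H2 * H2) (D : set (W * W)) :
  (forall u, A u -> D (osum u 0)) ->
  (forall w, D w -> boundary_form w (osum v1 v2) = 0) -> adjoint A v1.
Proof.
move=> AD Dv; apply/adjointP => u Au.
by have := Dv _ (AD u Au); rewrite boundary_form_osum boundary_form0l addr0.
Qed.

Lemma coupling_Gamma1_B1 : condition_B1 Gamma1.
Proof.
move=> _ _ [u1 [u2 [h' [-> Au chiu]]]] [v1 [v2 [k' [-> Av chiv]]]].
apply/green_identityE => /=; rewrite boundary_form_osum (triplet_green triplet)//.
move/chiU : chiv => /(_ _ chiu)/green_identityE /= ->.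
by rewrite /boundary_form /= !innerE; ring.
Qed.

Lemma coupling_Gamma1_rker : rker Gamma1 = coupling_H1 A G0 G1 chi.
Proof.
apply/seteqP; split=> w.
  move=> [u1 [u2 [h' [[-> /esym/eqP h0 /esym/eqP u0] Au chiu]]]].
  exists u1, u2; move: u0 h0 chiu; rewrite oppr_eq0 addrC addr_eq0.
  move=> /eqP -> /eqP -> chiu; split=> //; split=> //; by exists (0, - G1 u1).
move=> [u1 [u2 [-> [Au _] u0 chiu]]]; exists u1, u2, (- G1 u1).
by rewrite u0 subrr oppr0.
Qed.

Lemma coupling_Gamma1_minimal (u : H1 * H1) : A u -> rker Gamma1 (osum u 0).
Proof.
move=> /(triplet_minimal symA triplet)[Au u0 u1].
by exists u, 0, 0; rewrite u0 u1 oppr0 addr0.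
Qed.

(** For v with boundary values {k, k'} the pairs u1 with Gamma0 u1 = 0 and u2 = 0
force k' = - Gamma0 v1.  Then for any element {u2, {h, h'}} of chi one takes u1
with Gamma0 u1 = h and Gamma1 u1 = 0, and the maximality of chi applies. *)
Lemma coupling_Gamma1_unitary : unitary_relation Gamma1.
Proof.
move=> v; split=> [Gv u Gu|]; first exact: coupling_Gamma1_B1.
case: v => w [k k']; have [v1 [v2 ->]] := osum_surj w => Gv.
have Av : adjoint A v1.
  apply: (@coupling_adjoint _ v2 (rker Gamma1)) => [|u Gu].
    exact: coupling_Gamma1_minimal.
  by have /green_identityE := Gv _ Gu; rewrite boundary_form0l.
have green u1 u2 h' : adjoint A u1 -> chi (u2, (G0 u1, h')) ->
    '[G1 u1, G0 v1] - '[G0 u1, G1 v1] + boundary_form u2 v2 =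
    '[- G0 u1, k] - '[G1 u1 + h', k'].
  move=> Au chiu; rewrite -(triplet_green triplet)// -boundary_form_osum.
  have Gu : Gamma1 (osum u1 u2, (G1 u1 + h', - G0 u1)) by exists u1, u2, h'.
  by have /green_identityE := Gv _ Gu.
have k'E : k' = - G0 v1.
  apply/eqP; rewrite -addr_eq0; apply/eqP/inner_eq0.
  have [u [Au u0 u1]] := triplet_surjective triplet 0 (k' + G0 v1).
  have /(_ 0 0) := green u _ _ Au; rewrite u0 u1 => /(_ chi0).
  rewrite boundary_form0l !innerE => /eqP; rewrite -subr_eq0 => /eqP <-; ring.
exists v1, v2, (k - G1 v1); split=> //.
  by rewrite k'E addrC subrK.
apply/chiU => -[u2 [h h']] chiu; apply/green_identityE => /=.
have [u [Au u0 u1]] := triplet_surjective triplet h 0.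
have := green u u2 h' Au; rewrite u0 u1 => /(_ chiu).
rewrite k'E !innerE /boundary_form /= !innerE => /eqP; rewrite -subr_eq0.
move=> gr; apply/eqP; rewrite -subr_eq0 -(eqP gr); apply/eqP; ring.
Qed.

(** The first component alone reaches every value, with zero in the second. *)
Lemma coupling_Gamma1_B2 : condition_B2 Gamma1.
Proof.
apply/seteqP; split=> // h _.
have [u [Au u0 u1]] := triplet_surjective triplet 0 h.
by exists (osum u 0), (- G0 u), u, 0, 0; rewrite u0 u1 addr0.
Qed.

Lemma coupling_Gamma1_kernelP (u1 : H1 * H1) (u2 : H2 * H2) :
  rker (gamma0 Gamma1) (osum u1 u2) <->
    adjoint A u1 /\ chi (u2, (G0 u1, - G1 u1)).
Proof.
split=> [[k [v1 [v2 [h' [E Av]]]]]|[Au chiu]].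
  move/pair_equal_spec: E => [/osum_inj[-> ->] /pair_equal_spec[/esym/eqP h0 _]].
  by move: h0; rewrite addrC addr_eq0 => /eqP ->.
by exists (- G0 u1), u1, u2, (- G1 u1); rewrite subrr.
Qed.

(** The argument for unitarity, now with Gamma0 u1 = h and Gamma1 u1 = - h',
which keeps the test element in the kernel. *)
Lemma coupling_Gamma1_B3 : condition_B3 Gamma1.
Proof.
apply/seteqP; split=> w.
  move=> [k Gw]; apply/adjointP => w' [k' Gw'].
  have /green_identityE := coupling_Gamma1_B1 Gw' Gw.
  by rewrite /= {2}/boundary_form /= inner0l inner0r subrr.
have [v1 [v2 ->]] := osum_surj w => /adjointP kerv.
have Av : adjoint A v1.
  apply: (coupling_adjoint _ kerv) => u Au.
  by exists 0; exact: coupling_Gamma1_minimal.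
apply/coupling_Gamma1_kernelP; split=> //.
apply/chiU => -[u2 [h h']] chiu; apply/green_identityE => /=.
have [u [Au u0 u1]] := triplet_surjective triplet h (- h').
have : boundary_form (osum u u2) (osum v1 v2) = 0.
  by apply/kerv/coupling_Gamma1_kernelP; rewrite u0 u1 opprK.
rewrite boundary_form_osum (triplet_green triplet)// u0 u1.
rewrite /boundary_form /= !innerE => vv; apply/eqP.
by rewrite -subr_eq0 -vv; apply/eqP; ring.
Qed.

Theorem coupling_Gamma1_boundary_relation :
  closed_symmetric_relation (coupling_H1 A G0 G1 chi) /\
  [/\ boundary_relation (coupling_H1 A G0 G1 chi) Gamma1,
      condition_B1 Gamma1, condition_B2 Gamma1 & condition_B3 Gamma1].
Proof.
have := unitary_boundary_relation coupling_Gamma1_unitary.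
rewrite coupling_Gamma1_rker => br; split; first by case: br.
split=> //; [exact: coupling_Gamma1_B1 | exact: coupling_Gamma1_B2 |].
exact: coupling_Gamma1_B3.
Qed.

End Couplings.

(** * The rotated coupling *)

Section FlippedCoupling.
Context {R : realType} {H1 H2 H : hilbertType R}.

(** The quarter turn from {h, h'} to {- h', h}, which preserves the boundary form
and, together with the triplet {Gamma1, - Gamma0}, interchanges the couplings. *)
Definition flip_relation (chi : set ((H2 * H2) * (H * H))) :
    set ((H2 * H2) * (H * H)) :=
  [set w | chi (w.1, (w.2.2, - w.2.1))].

Lemma flip_unitary chi : unitary_relation chi ->
  unitary_relation (flip_relation chi).
Proof.
have green (u1 v1 : H2 * H2) (h h' k k' : H) :
    green_identity (u1, (- h', h)) (v1, (k, k')) <->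
    green_identity (u1, (h, h')) (v1, (k', - k)).
  have kE : boundary_form (- h', h) (k, k') = boundary_form (h, h') (k', - k).
    by rewrite /boundary_form /= !innerE; ring.
  by split=> /green_identityE /= uv; apply/green_identityE; rewrite /= uv kE.
move=> chiU [v [k k']]; split=> [/chiU chiv [u [h' h]]|chiv].
  by move=> /chiv /green; rewrite opprK.
apply/chiU => -[u [h h']] chiu; apply/green; apply: chiv.
by rewrite /flip_relation /= opprK.
Qed.

Variables (A : set (H1 * H1)) (G0 G1 : H1 * H1 -> H).
Variable (chi : set ((H2 * H2) * (H * H))).

Lemma coupling_H2_flip : coupling_H2 A G0 G1 chi =
  coupling_H1 A G1 (fun u => - G0 u) (flip_relation chi).
Proof.
apply/seteqP; split=> w [u1 [u2 [-> [Au _] u0 chiu]]]; exists u1, u2.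
  rewrite /flip_relation /= opprK oppr0; split=> //; split=> //.
  by exists (0, G0 u1); rewrite /= oppr0.
move: chiu; rewrite /flip_relation /= opprK oppr0 => chiu.
by split=> //; split=> //; exists (G0 u1, 0).
Qed.

Lemma coupling_Gamma2_flip : coupling_Gamma2 A G0 G1 chi =
  coupling_Gamma1 A G1 (fun u => - G0 u) (flip_relation chi).
Proof. by []. Qed.

End FlippedCoupling.

(** * Weyl functions of the couplings *)

Section WeylFunctions.
Context {R : realType}.
Local Notation C := R[i].

Lemma bounded_inverse_bijection (H : hilbertType R) (F : H -> H) (c : C) :
  linear F -> (forall h, exists k, F k = h) ->
  (forall k, `|k| <= c * `|F k|) -> exists K, bounded_inverse F K.
Proof.
move=> Fl Fsurj Fc.
pose L : {linear H -> H} := HB.pack F (GRing.isLinear.Build C H H *:%R F Fl).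
have Finj : injective F.
  move=> u v uv; apply/subr0_eq/eqP; rewrite -normr_le0.
  have -> : 0 = c * `|F (u - v)|; last exact: Fc.
  by rewrite -[F]/(L : H -> H) linearB /= uv subrr normr0 mulr0.
have [K KF] := choice Fsurj.
have Kl : linear K by move=> a u v; apply: Finj; rewrite Fl !KF.
pose K' : {linear H -> H} := HB.pack K (GRing.isLinear.Build C H H *:%R K Kl).
exists K'; split=> [|k|h]; last exact: KF.
  by exists c => h; rewrite -{2}(KF h); exact: Fc.
by apply: Finj; exact: KF.
Qed.

(** The constant in a bound is an arbitrary complex number; monotonicity
arguments need a nonnegative one. *)
Lemma bounded_operator_ge0 (H : hilbertType R) (T : {linear H -> H}) :
  bounded_operator T -> exists2 c : C, 0 <= c & forall x, `|T x| <= c * `|x|.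
Proof.
move=> [c cP]; exists `|c| => // x.
rewrite (le_trans (cP x))// -(ger0_norm (le_trans (normr_ge0 _) (cP x))).
by rewrite normrM normr_id.
Qed.

Lemma nonreal_subJ_neq0 (z : C) : nonreal z -> z - z^* != 0.
Proof.
rewrite /nonreal /=; apply: contra; rewrite subr_eq0 eq_sym => /eqP/CrealP.
by move/Creal_ImP/eqP.
Qed.

(** From the bounded inverse of Psi + i Phi or of Psi - i Phi, according to the
half-plane of z. *)
Lemma nevanlinna_pair_bounded_below (H : hilbertType R)
    (Phi Psi : C -> {linear H -> H}) (z : C) :
  nevanlinna_pair Phi Psi -> nonreal z ->
  exists2 c : C, 0 <= c & forall k, `|k| <= c * (`|Psi z k| + `|Phi z k|).
Proof.
move=> [_ _ _ _ [Kp Kn]] z0.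
have [a [K [a1 [Kb KK _]]]] : exists (a : C) K, `|a| = 1 /\
    bounded_inverse (fun h => Psi z h + a *: Phi z h) K.
  have /orP[zp|zn] : (0 < 'Im z) || ('Im z < 0).
    by rewrite orbC -real_neqr_lt ?Creal_Im ?real0.
  - by have [K KK] := Kp z zp; exists 'i, K; rewrite normCi.
  - have [K [Kb KK KK']] := Kn z zn; exists (- 'i), K; rewrite normrN normCi.
    by split=> //; split=> // k; rewrite scaleNr; [exact: KK|exact: KK'].
have [c c0 cP] := bounded_operator_ge0 Kb; exists c => // k.
rewrite -{1}(KK k) (le_trans (cP _))// ler_wpM2l//.
by rewrite (le_trans (ler_normD _ _))// normrZ a1 mul1r.
Qed.

Section Coupling.
Context {H1 H2 H : hilbertType R}.
Variables (A : set (H1 * H1)) (G0 G1 : H1 * H1 -> H).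
Variables (M Phi Psi : C -> {linear H -> H}).
Variable (chi : set ((H2 * H2) * (H * H))) (z : C).
Hypothesis symA : symmetric_relation A.
Hypothesis triplet : boundary_triplet A G0 G1.
Hypothesis weylM : triplet_weyl_function A G0 G1 M.
Hypothesis chiU : unitary_relation chi.
Hypothesis pair : nevanlinna_pair Phi Psi.
Hypothesis z0 : nonreal z.
Hypothesis weyl_chi : weyl_family chi z = pair_relation (Phi z) (Psi z).
Local Notation F := (fun h => Psi z h + M z (Phi z h)).

Lemma triplet_defect_weyl (h : H) : exists f, [/\ adjoint A (f, z *: f),
  G0 (f, z *: f) = h & G1 (f, z *: f) = M z h].
Proof.
have [f [Af fh]] := triplet_defect_surjective symA triplet h z0.
by exists f; split=> //; rewrite (weylM z0).2// fh.
Qed.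

Lemma weyl_chiP (h h' : H) :
  (exists f, chi ((f, z *: f), (h, h'))) <->
  exists k, h = Phi z k /\ h' = Psi z k.
Proof.
have := congr1 (fun X : set _ => X (h, h')) weyl_chi.
rewrite /weyl_family /pair_relation /= => ->.
by split=> [[k _ [<- <-]]|[k [-> ->]]]; exists k.
Qed.

Lemma weyl_coupling_Gamma1 (h h' : H) :
  weyl_family (coupling_Gamma1 A G0 G1 chi) z (h, h') <->
  exists k, h = F k /\ h' = - Phi z k.
Proof.
split=> [[f [u1 [u2 [x [E Au chiu]]]]]|[k [-> ->]]].
  move/pair_equal_spec: E => [fE /pair_equal_spec[-> ->]].
  move: fE Au chiu; case: f u1 u2 => [f1 f2] [a a'] [b b'] [<- <- <- <-] Au chiu.
  have [k [k0 ->]] := (weyl_chiP _ _).1 (ex_intro _ _ chiu).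
  by exists k; rewrite k0 (weylM z0).2// k0 addrC.
have [f2 chif] : exists f, chi ((f, z *: f), (Phi z k, Psi z k)).
  by apply/weyl_chiP; exists k.
have [f1 [Af f0 f0']] := triplet_defect_weyl (Phi z k).
exists ((f1, f2) : hsum H1 H2), (f1, z *: f1), (f2, z *: f2), (Psi z k).
by rewrite f0 f0' addrC.
Qed.

(** A defect element f = f1 + f2 of the coupling with boundary values
{F k, - Phi k} satisfies |z - z^*| |f|^2 <= 2 |F k| |Phi k| by Green's identity,
while |Phi k|^2 = |Gamma0 f1|^2 is bounded by a multiple of |f1|^2.  Dividing
by |Phi k| gives the bound. *)
Lemma coupling_defect_bound : exists2 c : C, 0 <= c &
  forall k, `|Phi z k| <= c * `|F k|.
Proof.
have [c c0 cP] := triplet_defect_bounded triplet z.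
have w0 : 0 < `|z - z^*| by rewrite normr_gt0 nonreal_subJ_neq0.
exists (c * 2 / `|z - z^*|) => [|k]; first by rewrite divr_ge0 ?mulr_ge0.
have [f2 chif] : exists f, chi ((f, z *: f), (Phi z k, Psi z k)).
  by apply/weyl_chiP; exists k.
have [f1 [Af f0 f0']] := triplet_defect_weyl (Phi z k).
pose f : hsum H1 H2 := (f1, f2).
have Gf : coupling_Gamma1 A G0 G1 chi ((f, z *: f), (F k, - Phi z k)).
  exists (f1, z *: f1), (f2, z *: f2), (Psi z k).
  by rewrite f0 f0' addrC.
have /green_identityE := coupling_Gamma1_B1 triplet chiU Gf Gf.
rewrite boundary_form_eigen => green.
have : `|z - z^*| * `|f1| ^+ 2 <= 2 * (`|Phi z k| * `|F k|).
  apply: (@le_trans _ _ (`|z - z^*| * `|f| ^+ 2)).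
    rewrite ler_wpM2l// !normr_inner inner_hsum lerDl.
    by rewrite -normr_inner exprn_ge0.
  rewrite -{1}(ger0_norm (exprn_ge0 2 (normr_ge0 f))) -normrM green.
  rewrite (le_trans (boundary_form_le _ _))//= normrN mulr_natl mulr2n.
  by rewrite (mulrC `|F k|).
have [->|p0] := eqVneq (Phi z k) 0.
  by rewrite normr0 !mulr_ge0 ?invr_ge0.
have n0 : 0 < `|Phi z k| by rewrite normr_gt0.
rewrite -ler_pdivlMl// => f1le.
rewrite -(ler_pM2l n0) -expr2 -f0 (le_trans (cP _ Af))//.
apply: le_trans (ler_wpM2l c0 f1le) _; rewrite f0.
by rewrite le_eqVlt; apply/orP; left; apply/eqP; ring.
Qed.

(** Surjectivity is the full domain of the Weyl family of the coupling.  For the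
lower bound, F k controls Phi k, hence Psi k = F k - M Phi k, hence k. *)
Theorem coupling_bounded_inverse : exists K, bounded_inverse F K.
Proof.
have [cM cM0 cMP] := bounded_operator_ge0 (weylM z0).1.
have [c c0 cP] := coupling_defect_bound.
have [d d0 dP] := nevanlinna_pair_bounded_below pair z0.
apply: (@bounded_inverse_bijection _ _ (d * ((1 + cM * c) + c))) => [a u v|h|k].
- by rewrite !linearP scalerDr addrACA.
- have [_ [_ _ B2 B3]] := coupling_Gamma1_boundary_relation symA triplet chiU.
  have lin := unitary_linear (coupling_Gamma1_unitary symA triplet chiU).
  have [f [h' Gf]] := weyl_family_domain h lin B2 B3 z0.
  have /weyl_coupling_Gamma1[k [-> _]] :
    weyl_family (coupling_Gamma1 A G0 G1 chi) z (h, h') by exists f.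
  by exists k.
- apply: le_trans (dP k) _; rewrite -mulrA ler_wpM2l// mulrDl lerD//.
  rewrite -{1}[Psi z k](addrK (M z (Phi z k))) (le_trans (ler_normB _ _))//.
  rewrite mulrDl mul1r lerD2l (le_trans (cMP _))// -mulrA ler_wpM2l//.
Qed.

Theorem coupling_Gamma1_weyl_function (K : {linear H -> H}) :
  bounded_inverse F K ->
  weyl_family (coupling_Gamma1 A G0 G1 chi) z =
    op_graph (fun h => - Phi z (K h)).
Proof.
move=> [_ FK KF]; apply/seteqP; split=> -[h h'].
  move=> /weyl_coupling_Gamma1[k [-> ->]]; rewrite /op_graph /=.
  by rewrite (FK k).
rewrite /op_graph /= => ->; apply/weyl_coupling_Gamma1; exists (K h).
by rewrite (KF h).
Qed.

(** A defect element has boundary values {Phi k - x, Psi k} with x = Gamma0 f1 and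
M x = - Psi k.  For h = Phi k - x this means M h = (Psi + M Phi) k, so k is
determined by h, and conversely x := Phi k - h solves the equation. *)
Theorem coupling_Gamma2_weyl_function (K : {linear H -> H}) :
  bounded_inverse F K ->
  weyl_family (coupling_Gamma2 A G0 G1 chi) z =
    op_graph (fun h => Psi z (K (M z h))).
Proof.
move=> [_ FK KF]; apply/seteqP; split=> -[h h'].
  move=> [f [u1 [u2 [x [E Au chiu]]]]].
  move/pair_equal_spec: E => [fE /pair_equal_spec[-> ->]].
  move: fE Au chiu; case: f u1 u2 => [f1 f2] [a a'] [b b'] [<- <- <- <-] Au chiu.
  have [k [-> k1]] := (weyl_chiP _ _).1 (ex_intro _ _ chiu).
  rewrite /op_graph /= k1; congr (Psi z _).
  by rewrite linearD linearN -(weylM z0).2// k1 addrC -(FK k) addrC.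
rewrite /op_graph /= => ->; set k := K (M z h).
have kE : Psi z k + M z (Phi z k) = M z h := KF (M z h).
have [f2 chif] : exists f, chi ((f, z *: f), (Phi z k, Psi z k)).
  by apply/weyl_chiP; exists k.
have [f1 [Af f0 f0']] := triplet_defect_weyl (Phi z k - h).
have Mx : - M z (Phi z k - h) = Psi z k.
  by rewrite linearB /= -kE opprB addrK.
exists ((f1, f2) : hsum H1 H2), (f1, z *: f1), (f2, z *: f2), (Phi z k).
by rewrite f0 f0' Mx opprB subrK.
Qed.

End Coupling.
End WeylFunctions.

(** * The coupling theorem *)

Theorem theorem6p12 (R : realType) (H1 H2 H : hilbertType R)
    (A : set (H1 * H1)) (G0 G1 : H1 * H1 -> H) (M : R[i] -> {linear H -> H})
    (S2 : set (H2 * H2)) (chi : set ((H2 * H2) * (H * H)))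
    (Phi Psi : R[i] -> {linear H -> H}) :
  closed_symmetric_operator A ->
  equal_defect_numbers A ->
  boundary_triplet A G0 G1 ->
  triplet_weyl_function A G0 G1 M ->
  closed_symmetric_operator S2 ->
  boundary_relation S2 chi ->
  nevanlinna_family (weyl_family chi) ->
  nevanlinna_pair Phi Psi ->
  (forall z, nonreal z -> weyl_family chi z = pair_relation (Phi z) (Psi z)) ->
  [/\ closed_symmetric_relation (coupling_H1 A G0 G1 chi),
      [/\ boundary_relation (coupling_H1 A G0 G1 chi)
            (coupling_Gamma1 A G0 G1 chi),
          condition_B1 (coupling_Gamma1 A G0 G1 chi),
          condition_B2 (coupling_Gamma1 A G0 G1 chi) &
          condition_B3 (coupling_Gamma1 A G0 G1 chi)] &
      forall z, nonreal z -> exists K : {linear H -> H},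
        bounded_inverse (fun h => Psi z h + M z (Phi z h)) K /\
        weyl_family (coupling_Gamma1 A G0 G1 chi) z =
          op_graph (fun h => - Phi z (K h))] /\
  [/\ closed_symmetric_relation (coupling_H2 A G0 G1 chi),
      [/\ boundary_relation (coupling_H2 A G0 G1 chi)
            (coupling_Gamma2 A G0 G1 chi),
          condition_B1 (coupling_Gamma2 A G0 G1 chi),
          condition_B2 (coupling_Gamma2 A G0 G1 chi) &
          condition_B3 (coupling_Gamma2 A G0 G1 chi)] &
      forall z, nonreal z -> exists K : {linear H -> H},
        bounded_inverse (fun h => Psi z h + M z (Phi z h)) K /\
        weyl_family (coupling_Gamma2 A G0 G1 chi) z =
          op_graph (fun h => Psi z (K (M z h)))].
Proof.
move=> [[_ _ symA] _] _ triplet weylM _ S2chi _ pair weyl_chi.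
have chiU := boundary_relation_unitary S2chi.
have flipU := flip_unitary chiU.
have tripletF := boundary_triplet_flip triplet.
have [H1s H1b] := coupling_Gamma1_boundary_relation symA triplet chiU.
have [H2s H2b] := coupling_Gamma1_boundary_relation symA tripletF flipU.
split.
  split=> // z z0.
  have [K FK] := coupling_bounded_inverse symA triplet weylM chiU pair z0
    (weyl_chi z z0).
  exists K; split=> //.
  exact: (coupling_Gamma1_weyl_function symA triplet weylM z0 (weyl_chi z z0)).
rewrite coupling_H2_flip coupling_Gamma2_flip.
split=> // z z0.
have [K FK] := coupling_bounded_inverse symA triplet weylM chiU pair z0
  (weyl_chi z z0).
exists K; split=> //.
exact: (coupling_Gamma2_weyl_function symA triplet weylM z0 (weyl_chi z z0)).
Qed.
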